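(* Let $n\ge1$ and $g\in S_{2n}$. Then $D^g$ is a path for all $D\in\mathcal{D}_n$ if and only if $g\in G$, where $G\le S_{2n}$ is the dihedral group generated by $\rho$ and $\omega$.
   Context: A Dyck path of size $n$ is a word in $\mathtt{u},\mathtt{d}$ with $n$ of each letter whose every prefix has at least as many $\mathtt{u}$'s as $\mathtt{d}$'s; $\mathcal{D}_n$ is their set. The tunneling $\tau_D\in S_{2n}$ of $D$ is the fixed-point-free involution pairing each up-step position with the position of its matching down-step. For $g\in S_{2n}$, $D^g$ denotes the pairing of $[2n]$ with tunneling $\tau_{D^g}$ given by $\tau_{D^g}(g(k))=g(\tau_D(k))$ for all $k$ (the chord diagram of $D$ with labels permuted by $g$); $D^g$ is a path if $\tau_{D^g}=\tau_P$ for some $P\in\mathcal{D}_n$. The permutations $\rho,\omega\in S_{2n}$ are $\rho(k)=k+1$ and $\omega(k)=2n-k$, with arithmetic modulo $2n$ and values taken in $[2n]$ (rotation and reflection of the $2n$ labels on a circle); $G=\langle\rho,\omega\rangle$. *)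

(* Defs.v *)
From HB Require Import structures.
From mathcomp Require Import all_boot all_fingroup zify.

Set Implicit Arguments.
Unset Strict Implicit.
Unset Printing Implicit Defensive.

Local Open Scope nat_scope.

(* Steps: u is [true], d is [false]. *)
Local Notation up := true (only parsing).
Local Notation down := false (only parsing).

Definition dyck_word (n : nat) (w : seq bool) : bool :=
  [&& count_mem up w == n, count_mem down w == n
    & [forall k : 'I_(size w).+1,
         count_mem down (take k w) <= count_mem up (take k w)]].

Record dyck (n : nat) := Dyck {
  dyck_val :> (2 * n).-tuple bool;
  dyck_valP : dyck_word n dyck_val }.

HB.instance Definition _ (n : nat) := [isSub for @dyck_val n].
HB.instance Definition _ (n : nat) := [Finite of dyck n by <:].

(* The letters strictly between positions i < j. *)
Definition between (w : seq bool) (i j : nat) : seq bool :=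
  take (j - i.+1) (drop i.+1 w).

(* w = A u B d C with B a Dyck word, the displayed u and d being at i and j. *)
Definition matched (w : seq bool) (i j : nat) : bool :=
  [&& i < j, nth down w i == up, nth up w j == down
    & dyck_word (j - i.+1)./2 (between w i j)].

Section Tunneling.

Variables (n : nat) (D : dyck n).

Let hu k := count_mem up (take k D).
Let hd k := count_mem down (take k D).

Let size_D : size D = 2 * n. Proof. exact: size_tuple. Qed.

Let hud k : hd k <= hu k.
Proof.
have /and3P[_ _ /forallP H] := dyck_valP D.
have [kle|klt] := leqP k (size D); first exact: (H (Ordinal (kle : k < (size D).+1))).
have := H ord_max; rewrite /hd /hu /= !take_oversize //; exact: ltnW.
Qed.

Let hu_end : hu (2 * n) = n.
Proof. by have /and3P[/eqP H _ _] := dyck_valP D; rewrite /hu take_oversize ?size_D. Qed.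

Let hd_end : hd (2 * n) = n.
Proof. by have /and3P[_ /eqP H _] := dyck_valP D; rewrite /hd take_oversize ?size_D. Qed.

Let huS k : k < 2 * n -> hu k.+1 = hu k + nth down D k.
Proof.
move=> kn; rewrite /hu (take_nth down) ?size_D // -cats1 count_cat /=.
by case: (nth _ _ _).
Qed.

Let hdS k : k < 2 * n -> hd k.+1 = hd k + ~~ nth down D k.
Proof.
move=> kn; rewrite /hd (take_nth down) ?size_D // -cats1 count_cat /=.
by case: (nth _ _ _).
Qed.

Let count_mid (x : bool) i k : count_mem x (take (i + k) D) =
  count_mem x (take i D) + count_mem x (take k (drop i D)).
Proof. by rewrite takeD count_cat. Qed.

Let matchedE (i j : 'I_(2 * n)) : reflect
  [/\ i < j, nth down D i, ~~ nth down D j, hu i.+1 + hd j = hu j + hd i.+1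
    & forall k, i < k <= j -> hu i.+1 + hd k <= hu k + hd i.+1]
  (matched D i j).
Proof.
have jn := ltn_ord j; have ijn := ltn_ord i.
rewrite /matched (set_nth_default down up) ?size_D // eqb_id eqbF_neg.
apply: (iffP and4P) => [[ij ui dj]|[ij ui dj e H]].
- case/and3P=> /eqP eu /eqP ed /forallP H.
  have szb : size (between D i j) = j - i.+1.
    by rewrite size_takel // size_drop size_D; lia.
  have ju := count_mid up i.+1 (j - i.+1).
  have jd := count_mid down i.+1 (j - i.+1).
  rewrite subnKC // in ju jd; rewrite -/(between _ _ _) in ju jd.
  split=> //; first by rewrite /hu /hd ju jd eu ed; lia.
  move=> k /andP[ik kj].
  have kl : k - i.+1 < (size (between D i j)).+1 by rewrite szb; lia.
  have := H (Ordinal kl) => /=.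
  rewrite /between take_takel; last by lia.
  have := count_mid up i.+1 (k - i.+1); have := count_mid down i.+1 (k - i.+1).
  rewrite subnKC // /hu /hd => -> -> /=; lia.
- split=> //.
  have szb : size (between D i j) = j - i.+1.
    by rewrite size_takel // size_drop size_D; lia.
  have ju := count_mid up i.+1 (j - i.+1).
  have jd := count_mid down i.+1 (j - i.+1).
  rewrite subnKC // in ju jd; rewrite -/(between _ _ _) in ju jd.
  move: e; rewrite /hu /hd ju jd => e.
  have tot : count_mem up (between D i j) + count_mem down (between D i j)
             = j - i.+1.
    rewrite -szb -(count_predC (pred1 up)); congr (_ + _).
    by apply: eq_count; case.
  apply/and3P; split; [apply/eqP; lia | apply/eqP; lia |].
  apply/forallP=> -[k kl] /=; rewrite szb in kl.
  have /H : i < i.+1 + k <= j by lia.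
  rewrite /hu /hd !count_mid /between take_takel; last by lia.
  by move=> /=; lia.
Qed.

Let partner (i j : 'I_(2 * n)) := matched D i j || matched D j i.

Let partner_uniq i j k : partner i j -> partner i k -> j = k.
Proof.
have key (a b c : 'I_(2 * n)) : matched D a b -> matched D a c -> b < c -> False.
  case/matchedE=> ab ua db e H /matchedE[ac _ dc e' H'] bc.
  have /H' : a < b.+1 <= c by lia.
  rewrite (huS (ltn_ord b)) (hdS (ltn_ord b)) (negbTE db) /=; lia.
have key' (a b c : 'I_(2 * n)) : matched D b a -> matched D c a -> b < c -> False.
  case/matchedE=> ab ua db e H /matchedE[ac uc dc e' H'] bc.
  have /H : b < c <= a by lia.
  move: e'; rewrite (huS (ltn_ord c)) (hdS (ltn_ord c)) uc /=; lia.
move=> pj pk; apply/val_inj => /=; case: (ltngtP j k) => // jk; exfalso.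
- case/orP: pj; case/orP: pk => m1 m2.
  + exact: key m2 m1 jk.
  + by case/matchedE: m1 => _ _ /negP d _ _; case/matchedE: m2 => _ /d.
  + by case/matchedE: m1 => _ u _ _ _; case/matchedE: m2 => _ _ /negP[].
  + exact: key' m2 m1 jk.
- case/orP: pj; case/orP: pk => m1 m2.
  + exact: key m1 m2 jk.
  + by case/matchedE: m1 => _ _ /negP d _ _; case/matchedE: m2 => _ /d.
  + by case/matchedE: m1 => _ u _ _ _; case/matchedE: m2 => _ _ /negP[].
  + exact: key' m1 m2 jk.
Qed.

Let partner_ex i : exists j, partner i j.
Proof.
have iN := ltn_ord i.
case ui: (nth down D i).
- pose Q j := [&& i < j, j < 2 * n & hu j.+1 + hd i <= hu i + hd j.+1].
  have hui := huS iN; have hdi := hdS iN; rewrite ui /= in hui hdi.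
  have exQ : exists j, Q j.
    exists (2 * n).-1; rewrite /Q prednK; last by lia.
    have := hud i; rewrite hu_end hd_end => h.
    have : i != (2 * n).-1 :> nat.
      apply/eqP => ei; move: hui hdi; rewrite ei prednK; last by lia.
      rewrite -ei hu_end hd_end; lia.
    by lia.
  case: (ex_minnP exQ) => j /and3P[ij jn Hj] minj.
  exists (Ordinal jn); apply/orP; left; apply/matchedE => /=.
  have huj := huS jn; have hdj := hdS jn.
  have H k : i < k <= j -> hu i.+1 + hd k <= hu k + hd i.+1.
    move=> /andP[ik kj]; have [ek|nk] := eqVneq k i.+1; first by rewrite ek; lia.
    rewrite leqNgt; apply/negP=> h.
    have : Q k.-1 by rewrite /Q prednK; lia.
    by move=> /minj; lia.
  have := H j; rewrite ij leqnn => /(_ isT) Hjj.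
  by move: huj hdj; case: (nth down D j) => /= *; split=> //; lia.
- pose Q j := [&& j < i & hu j + hd i.+1 <= hu i.+1 + hd j].
  have hui := huS iN; have hdi := hdS iN; rewrite ui /= in hui hdi.
  have h0 : hu 0 = 0 /\ hd 0 = 0 by rewrite /hu /hd take0.
  have exQ : exists j, Q j.
    exists 0; rewrite /Q; have := hud i.+1.
    case: (posnP i) => [ei|]; last by lia.
    by move: hui hdi; rewrite ei; lia.
  have ubQ j : Q j -> j <= i by case/andP=> /ltnW.
  case: (ex_maxnP exQ ubQ) => j /andP[ji Hj] maxj.
  have jn : j < 2 * n by lia.
  exists (Ordinal jn); apply/orP; right; apply/matchedE => /=.
  have huj := huS jn; have hdj := hdS jn.
  have H k : j < k <= i -> hu i + hd k <= hu k + hd i.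
    move=> /andP[jk ki]; have [->|nk] := eqVneq k i; first by lia.
    rewrite leqNgt; apply/negP=> h.
    have : Q k by rewrite /Q; lia.
    by move=> /maxj; lia.
  have := H j.+1; rewrite ji ltnSn => /(_ isT) Hjj.
  have [uj e] : nth down D j /\ hu j.+1 + hd i = hu i + hd j.+1.
    by move: huj hdj; case: (nth down D j) => /= *; split=> //; lia.
  split=> //; first by rewrite ui.
  by move=> k /H; lia.
Qed.

Definition tunnel_fun (i : 'I_(2 * n)) : 'I_(2 * n) :=
  odflt i [pick j : 'I_(2 * n) | matched D i j || matched D j i].

Lemma tunnel_funP (i : 'I_(2 * n)) :
  matched D i (tunnel_fun i) || matched D (tunnel_fun i) i.
Proof.
rewrite /tunnel_fun; case: pickP => //= none.
by have [j] := partner_ex i; rewrite /partner none.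
Qed.

Lemma tunnel_funK : involutive tunnel_fun.
Proof.
move=> i; apply: (@partner_uniq (tunnel_fun i)); first exact: tunnel_funP.
by rewrite /partner orbC; exact: tunnel_funP.
Qed.

Definition tunneling : 'S_(2 * n) := perm (can_inj tunnel_funK).

Lemma tunneling_matched (i j : 'I_(2 * n)) :
  (tunneling i == j) = matched D i j || matched D j i.
Proof.
rewrite permE; apply/eqP/idP => [<-|]; first exact: tunnel_funP.
exact: (partner_uniq (tunnel_funP i)).
Qed.

Lemma tunnelingK : involutive tunneling.
Proof. by move=> i; rewrite !permE tunnel_funK. Qed.

Lemma tunneling_fpf i : tunneling i != i.
Proof. by rewrite tunneling_matched orbb /matched ltnn. Qed.

End Tunneling.

(* D^g, a pairing being identified with its tunneling. In MathComp,
   [t ^ g] is g^-1 * t * g with products read left to right, so this is the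
   permutation sending g(k) to g(tunneling D k), see [relabelE]. *)
Definition relabel (n : nat) (D : dyck n) (g : 'S_(2 * n)) : 'S_(2 * n) :=
  (tunneling D ^ g)%g.

Lemma relabelE (n : nat) (D : dyck n) (g : 'S_(2 * n)) k :
  relabel D g (g k) = g (tunneling D k).
Proof. exact: permJ. Qed.

Definition is_path (n : nat) (t : 'S_(2 * n)) : Prop :=
  exists P : dyck n, t = tunneling P.

(* The label k in [2n] is the ordinal k - 1; modulo 2n, k - 1 is k + (2n - 1). *)
Definition rho (n : nat) : 'S_(2 * n) := perm (@ordS_inj (2 * n)).

Definition omega_fun (n : nat) (i : 'I_(2 * n)) : 'I_(2 * n) :=
  Ordinal (ltn_pmod (2 * n - i.+1 + (2 * n).-1)
                    (leq_ltn_trans (leq0n i) (ltn_ord i))).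

Lemma omega_funK (n : nat) : involutive (@omega_fun n).
Proof.
move=> i; apply/val_inj => /=; have iN := ltn_ord i.
have [e|ne] := eqVneq i.+1 (2 * n).
  have -> : (2 * n - i.+1 + (2 * n).-1) %% (2 * n) = i.
    by rewrite e subnn modn_small; lia.
  by rewrite e subnn modn_small; lia.
have -> : (2 * n - i.+1 + (2 * n).-1) %% (2 * n) = 2 * n - i.+2.
  have -> : 2 * n - i.+1 + (2 * n).-1 = 2 * n - i.+2 + 2 * n by lia.
  by rewrite modnDr modn_small //; lia.
have -> : 2 * n - (2 * n - i.+2).+1 + (2 * n).-1 = i + 2 * n by lia.
by rewrite modnDr modn_small.
Qed.

Definition omega (n : nat) : 'S_(2 * n) := perm (can_inj (@omega_funK n)).

Lemma rhoE (n : nat) (i : 'I_(2 * n)) :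
  (rho n i).+1 = i.+1 + 1 %[mod 2 * n].
Proof. by rewrite permE /= -[(_ %% _).+1]addn1 modnDml. Qed.

Lemma omegaE (n : nat) (i : 'I_(2 * n)) :
  (omega n i).+1 = 2 * n - i.+1 %[mod 2 * n].
Proof.
have iN := ltn_ord i.
rewrite permE /= -[(_ %% _).+1]addn1 modnDml.
have -> : 2 * n - i.+1 + (2 * n).-1 + 1 = 2 * n - i.+1 + 2 * n by lia.
by rewrite modnDr.
Qed.

Definition G (n : nat) : {group 'S_(2 * n)} :=
  <<[set rho n; omega n]>>%G.

(* Main.v *)
(** A permutation is the tunneling of a Dyck path iff it is a noncrossing
fixed-point-free involution, so the permutations [g] in question are those that
preserve noncrossing pairings; they form a group, which contains [rho] and
[omega]. Conversely, let [g] preserve noncrossing pairings. The paths [(ud)^n]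
and [ud u(ud)^(n-2)d] both contain the chord [{0, 1}], and together their other
chords link the points [2, ..., 2n-1] in a chain. Since no image of such a chord
crosses [{g 0, g 1}], one side of that chord is empty, that is [g 0] and [g 1]
are adjacent on the circle. Applied to [rho^i g], this shows that [g] preserves
adjacency, so composing [g] with an element of the dihedral group that brings
[g 0, g 1] back to [0, 1] yields the identity. *)

Require Import Defs.
From mathcomp Require Import all_boot all_fingroup zify.

Set Implicit Arguments.
Unset Strict Implicit.
Unset Printing Implicit Defensive.

(** * Noncrossing pairings of the labels *)

(** One order of endpoints is enough: of two crossing chords, take [i] to be the smallest endpoint
    and [j] the left endpoint of the other chord. *)
Definition noncrossing N (t : 'S_N) : bool :=
  [forall i : 'I_N, (t i != i) && (t (t i) == i)] &&
  [forall i : 'I_N, forall j : 'I_N, ~~ [&& i < j, j < t i & t i < t j]].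

Lemma noncrossingP N (t : 'S_N) :
  reflect [/\ forall i, t i != i, involutive t
            & forall i j : 'I_N, i < j -> j < t i -> t i < t j -> False]
          (noncrossing t).
Proof.
apply: (iffP andP) => [[/forallP inv /forallP nc]|[fpf inv nc]]; split.
- by move=> i; have /andP[] := inv i.
- by move=> i; have /andP[_ /eqP] := inv i.
- by move=> i j ij jt tt; have /forallP/(_ j) := nc i; rewrite ij jt tt.
- by apply/forallP=> i; rewrite fpf inv eqxx.
- apply/forallP=> i; apply/forallP=> j; apply/negP=> /and3P[ij jt tt].
  exact: nc ij jt tt.
Qed.

Lemma noncrossing_fun N (f : nat -> nat) :
    (forall i, i < N -> [/\ f i < N, f i != i & f (f i) = i]) ->
    (forall i j, i < j -> j < f i -> f i < f j -> f j < N -> False) ->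
  exists2 t : 'S_N, noncrossing t & forall i : 'I_N, t i = f i :> nat.
Proof.
move=> fP nc.
have fb (i : 'I_N) : f i < N by case: (fP i (ltn_ord i)).
pose F (i : 'I_N) := Ordinal (fb i).
have FK : involutive F by move=> i; apply/val_inj; case: (fP i (ltn_ord i)).
exists (perm (can_inj FK)) => [|i]; last by rewrite permE.
apply/noncrossingP; split=> [i|i|i j]; rewrite !permE ?FK //.
- by case: (fP i (ltn_ord i)).
- by move=> ij jt tt; apply: nc ij jt tt _; exact: fb.
Qed.

Lemma noncrossing_sides N (t : 'S_N) (x z : 'I_N) :
    noncrossing t -> z != x -> z != t x ->
  (minn x (t x) < z < maxn x (t x)) = (minn x (t x) < t z < maxn x (t x)).
Proof.
move=> /noncrossingP[fpf inv nc] zx ztx.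
have tzx : t z != x by rewrite -(inj_eq (@perm_inj _ t)) inv eq_sym in ztx *.
have tztx : t z != t x by rewrite (inj_eq perm_inj).
(* Were [z] and [t z] on different sides, the chords would cross; the eight instances cover every
   choice of the two left endpoints. *)
have := nc x z; have := nc x (t z); have := nc (t x) z; have := nc (t x) (t z).
have := nc z x; have := nc z (t x); have := nc (t z) x; have := nc (t z) (t x).
rewrite !inv; move: (fpf x) (fpf z) zx ztx tzx tztx; rewrite -!val_eqE /=.
move: (val x) (val z) (val (t x)) (val (t z)) => a b c d; lia.
Qed.

(** * Heights along a word, and why matched steps do not cross *)

Section Words.

Implicit Types (w : seq bool) (x : bool).

Definition cnt x w k := count_mem x (take k w).

Lemma cntD x w i k : cnt x w (i + k) = cnt x w i + cnt x (drop i w) k.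
Proof. by rewrite /cnt takeD count_cat. Qed.

Lemma cntS x w k : k < size w -> cnt x w k.+1 = cnt x w k + (nth false w k == x).
Proof.
by move=> kw; rewrite /cnt (take_nth false) // -cats1 count_cat /= addn0.
Qed.

Lemma dyck_word_prefix m w k : dyck_word m w -> cnt false w k <= cnt true w k.
Proof.
case/and3P=> _ _ /forallP H.
have [kle|klt] := leqP k (size w).
  exact: (H (Ordinal (kle : k < (size w).+1))).
by have := H ord_max; rewrite /cnt /= !take_oversize //; exact: ltnW.
Qed.

Lemma dyck_word_balanced m w : dyck_word m w -> count_mem false w = count_mem true w.
Proof. by case/and3P=> /eqP -> /eqP ->. Qed.

(** Between matched steps the height (ups minus downs) stays at least its value after [i], since the
    factor in between is a Dyck word. Sums replace differences to avoid truncated subtraction. *)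
Lemma matched_prefix w i j k : matched w i j -> i < k <= j ->
  cnt false w k + cnt true w i.+1 <= cnt true w k + cnt false w i.+1.
Proof.
case/and4P=> ij _ _ dw /andP[ik kj].
have := dyck_word_prefix (k - i.+1) dw.
rewrite /cnt /between take_takel; last by lia.
have := cntD true w i.+1 (k - i.+1); have := cntD false w i.+1 (k - i.+1).
rewrite subnKC // /cnt; lia.
Qed.

Lemma matched_balanced w i j : matched w i j ->
  cnt false w j + cnt true w i.+1 = cnt true w j + cnt false w i.+1.
Proof.
case/and4P=> ij _ _ /dyck_word_balanced; rewrite /between.
have := cntD true w i.+1 (j - i.+1); have := cntD false w i.+1 (j - i.+1).
rewrite subnKC // /cnt; lia.
Qed.

(* The height before [i'] is the height after [i], hence at most the height
   before [j], which is less than the height after [j], a minimum up to [j']. *)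
Lemma matched_noncrossing w i i' j j' : i' < size w ->
  matched w i i' -> matched w j j' -> i < j -> j < i' -> i' < j' -> False.
Proof.
move=> iw mi mj ij ji ij'.
have h1 := @matched_prefix _ _ _ j mi; have h2 := @matched_prefix _ _ _ i' mj.
have h3 := matched_balanced mi.
have /and4P[_ /eqP uj _ _] := mj.
have := cntS true (ltn_trans ji iw); have := cntS false (ltn_trans ji iw).
rewrite uj /=; lia.
Qed.

End Words.

Lemma tunneling_noncrossing n (D : dyck n) : noncrossing (tunneling D).
Proof.
have m (i : 'I_(2 * n)) : i < tunneling D i -> matched D i (tunneling D i).
  move=> it; have := tunneling_matched D i (tunneling D i).
  by rewrite eqxx => /esym/orP[//|] /and4P[]; lia.
apply/noncrossingP; split=> [i||i j ij jt tt].
- exact: tunneling_fpf.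
- exact: tunnelingK.
- have sz : tunneling D i < size D by rewrite size_tuple.
  have mi := m i (ltn_trans ij jt); have mj := m j (ltn_trans jt tt).
  exact: matched_noncrossing sz mi mj ij jt tt.
Qed.

(** * The Dyck path of a noncrossing pairing *)

Section PathOfMatching.

Variables (N : nat) (t : 'S_N).
Hypothesis tnc : noncrossing t.

Let fpf i : t i != i. Proof. by case/noncrossingP: tnc. Qed.
Let inv : involutive t. Proof. by case/noncrossingP: tnc. Qed.
Let nc (i j : 'I_N) : i < j -> j < t i -> t i < t j -> False.
Proof. by case/noncrossingP: tnc => _ _; apply. Qed.

Let gtNt (i : 'I_N) : (i < t i) = false -> t i < i.
Proof. by have := fpf i; rewrite -val_eqE /=; lia. Qed.

Definition up_steps : N.-tuple bool := [tuple i < t i | i < N].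

Let interval (x : bool) a k := [set i : 'I_N | (a <= i < a + k) && ((i < t i) == x)].

Lemma count_up_steps x a k :
  count_mem x (take k (drop a up_steps)) = #|interval x a k|.
Proof.
rewrite -map_drop -map_take count_map.
set s := take k _.
have us : uniq s by rewrite take_uniq ?drop_uniq ?enum_uniq.
have ms i : (i \in s) = (a <= i < a + k).
  rewrite -(mem_map val_inj) map_take map_drop val_enum_ord.
  rewrite drop_iota take_iota mem_iota /=; have := ltn_ord i; lia.
rewrite -size_filter -(card_uniqP _) ?filter_uniq //.
by apply: eq_card => i; rewrite mem_filter !inE ms andbC.
Qed.

(** In the window of length [k] from [a], [t] injects the right endpoints of chords into the left
    endpoints: a partner lies further left, and by hypothesis not before [a]. *)
Lemma down_le_up a k :
    (forall i : 'I_N, a <= i < a + k -> t i < i -> a <= t i) ->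
  count_mem false (take k (drop a up_steps))
    <= count_mem true (take k (drop a up_steps)).
Proof.
move=> cl; rewrite !count_up_steps -(card_imset _ (@perm_inj _ t)).
apply/subset_leq_card/subsetP=> _ /imsetP[i + ->].
rewrite !inE inv => /andP[ik /eqP/gtNt ti]; have := cl i ik ti.
lia.
Qed.

Lemma up_le_down a k :
    (forall i : 'I_N, a <= i < a + k -> i < t i -> t i < a + k) ->
  count_mem true (take k (drop a up_steps))
    <= count_mem false (take k (drop a up_steps)).
Proof.
move=> cl; rewrite !count_up_steps -(card_imset _ (@perm_inj _ t)).
apply/subset_leq_card/subsetP=> _ /imsetP[i + ->].
rewrite !inE inv => /andP[ik /eqP ti]; have := cl i ik ti.
lia.
Qed.

(** A window closed under [t] is balanced by the two inequalities above. Its prefixes contain the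
    partners of their right endpoints, so [down_le_up] applies to them too. *)
Lemma dyck_word_up_steps a k : a + k <= N ->
    (forall i : 'I_N, a <= i < a + k -> a <= t i < a + k) ->
  dyck_word k./2 (take k (drop a up_steps)).
Proof.
move=> akN cl; set w := take k _.
have sw : size w = k by rewrite size_takel // size_drop size_tuple; lia.
have tot : count_mem true w + count_mem false w = k.
  rewrite -sw -(count_predC (pred1 true) w); congr (_ + _).
  by apply: eq_count; case.
have le1 : count_mem true w <= count_mem false w.
  by apply: up_le_down => i /cl; lia.
have le2 : count_mem false w <= count_mem true w.
  by apply: down_le_up => i /cl; lia.
apply/and3P; split; [apply/eqP; lia | apply/eqP; lia |].
apply/forallP=> -[j /= jk]; rewrite sw in jk.
rewrite /w take_takel; last by lia.
by apply: down_le_up => i ij _; have := cl i; lia.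
Qed.

Lemma matched_up_steps (i : 'I_N) : i < t i -> matched up_steps i (t i).
Proof.
move=> it; have nthE d (j : 'I_N) : nth d up_steps j = (j < t j).
  by rewrite -tnth_nth tnth_mktuple.
apply/and4P; split; rewrite ?nthE ?inv ?it //; first by rewrite eqbF_neg; lia.
apply: dyck_word_up_steps => [|j]; first by have := ltn_ord (t i); lia.
rewrite subnKC // => /andP[ij jt].
(* The interior of a chord is closed under [t]: the first instance forbids [t j] beyond [t i], the
   second forbids it before [i]. *)
have := @nc i j; have := @nc (t j) i; rewrite inv.
have : t j != i by apply/eqP=> e; move: jt; rewrite -e inv ltnn.
have : t j != t i by rewrite (inj_eq perm_inj) -val_eqE /=; lia.
rewrite -!val_eqE /=; lia.
Qed.

End PathOfMatching.

Lemma is_path_noncrossing n (t : 'S_(2 * n)) : is_path t <-> noncrossing t.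
Proof.
split=> [[P ->]|tnc]; first exact: tunneling_noncrossing.
have [fpf inv _] := noncrossingP _ tnc.
have Pw : dyck_word n (up_steps t).
  have := @dyck_word_up_steps _ _ tnc 0 (2 * n) (leqnn _).
  rewrite drop0 take_oversize ?size_tuple //.
  have -> : (2 * n)./2 = n by lia.
  by apply=> i _; have := ltn_ord (t i); lia.
exists (Dyck Pw); apply/permP=> i; apply/esym/eqP; rewrite tunneling_matched /=.
have [it|ti] := ltnP i (t i); first by rewrite matched_up_steps.
have /(matched_up_steps tnc) : t i < t (t i).
  by rewrite inv; have := fpf i; rewrite -val_eqE /=; lia.
by rewrite inv => ->; rewrite orbT.
Qed.

(** * The group of permutations preserving noncrossing pairings *)

Lemma noncrossingJ N (t g : 'S_N) :
    noncrossing t ->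
    (forall i j : 'I_N, g i < g j -> g j < g (t i) -> g (t i) < g (t j) -> False) ->
  noncrossing (t ^ g)%g.
Proof.
move=> /noncrossingP[fpf inv _] nc; apply/noncrossingP.
have gV i : i = g ((g^-1)%g i) by rewrite permKV.
split=> [i|i|i j].
- by rewrite (gV i) permJ (inj_eq perm_inj).
- by rewrite (gV i) !permJ inv.
- by rewrite (gV i) (gV j) !permJ; exact: nc.
Qed.

Definition preserver N : {set 'S_N} :=
  [set g | [forall t : 'S_N, noncrossing t ==> noncrossing (t ^ g)%g]].

Lemma preserverP N (g : 'S_N) :
  reflect (forall t : 'S_N, noncrossing t -> noncrossing (t ^ g)%g)
          (g \in preserver N).
Proof.
by rewrite inE; apply: (iffP forallP) => H t; [apply/implyP|apply/implyP/H].
Qed.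

(** Identity and products suffice because the symmetric group is finite. *)
Lemma preserver_group_set N : group_set (preserver N).
Proof.
apply/group_setP; split=> [|g h /preserverP gP /preserverP hP]; apply/preserverP.
  by move=> t; rewrite conjg1.
by move=> t /gP/hP; rewrite conjgM.
Qed.
Canonical preserver_group N := Group (preserver_group_set N).

Lemma relabel_path_preserver n (g : 'S_(2 * n)) :
  (forall D : dyck n, is_path (relabel D g)) <-> g \in preserver (2 * n).
Proof.
split=> [H|/preserverP gP D].
  apply/preserverP=> t /is_path_noncrossing[P ->].
  exact/is_path_noncrossing/H.
exact/is_path_noncrossing/gP/tunneling_noncrossing.
Qed.

(** * The dihedral group preserves noncrossing pairings *)

Lemma rho_val n (i : 'I_(2 * n)) :
  rho n i = (if i.+1 == 2 * n then 0 else i.+1) :> nat.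
Proof.
rewrite permE /=; have := ltn_ord i.
by case: eqP => [->|ne] iN; [rewrite modnn | rewrite modn_small //; lia].
Qed.

(** The exceptional ordinal [2 * n - 1] is the label 2n, fixed because 2n - 2n = 0 stands for 2n. *)
Lemma omega_val n (i : 'I_(2 * n)) :
  omega n i = (if i.+1 == 2 * n then i : nat else 2 * n - i.+2) :> nat.
Proof.
rewrite permE /=; have := ltn_ord i.
case: eqP => [e|ne] iN; first by rewrite e subnn modn_small; lia.
have -> : 2 * n - i.+1 + (2 * n).-1 = 2 * n - i.+2 + 2 * n by lia.
by rewrite modnDr modn_small //; lia.
Qed.

Lemma rhoX_val n k (i : 'I_(2 * n)) : (rho n ^+ k)%g i = (i + k) %% (2 * n) :> nat.
Proof.
elim: k => [|k IH]; first by rewrite perm1 addn0 modn_small.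
by rewrite expgSr permM permE /= IH -[(_ %% _).+1]addn1 modnDml addn1 addnS.
Qed.

Lemma rho_preserver n : rho n \in preserver (2 * n).
Proof.
apply/preserverP=> t tnc; apply: noncrossingJ => // i j.
have [fpf inv nc] := noncrossingP _ tnc.
(* Rotation keeps the order of the four endpoints, except that the last label may move to the front;
   then [i] is last and [j], [t i], [t j], [i] increase. *)
have := nc i j; have := nc j (t i); rewrite inv !rho_val.
have := ltn_ord i; have := ltn_ord j.
have := ltn_ord (t i); have := ltn_ord (t j).
by do 4!case: eqP => ?; lia.
Qed.

Lemma omega_preserver n : omega n \in preserver (2 * n).
Proof.
apply/preserverP=> t tnc; apply: noncrossingJ => // i j.
have [fpf inv nc] := noncrossingP _ tnc.
(* Reflection reverses the order, except that the last label is fixed; then [t j] is last and [t i],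
   [j], [i], [t j] increase. *)
have := nc (t i) j; have := nc (t j) (t i); rewrite !inv !omega_val.
have := ltn_ord i; have := ltn_ord j.
have := ltn_ord (t i); have := ltn_ord (t j).
by do 4!case: eqP => ?; lia.
Qed.

Lemma G_sub_preserver n : G n \subset preserver (2 * n).
Proof.
by rewrite gen_subG subUset !sub1set rho_preserver omega_preserver.
Qed.

(** * Preservers respect adjacency on the circle *)

Lemma exists_ud_pairing n : exists2 t : 'S_(2 * n), noncrossing t
  & forall i : 'I_(2 * n), t i = (if odd i then i.-1 else i.+1) :> nat.
Proof.
pose f i := if odd i then i.-1 else i.+1.
apply: (@noncrossing_fun _ f) => [i iN|i j].
- by split; [| | rewrite [f i]/f; case: ifP => ?]; rewrite /f; case: ifP; lia.
- by rewrite /f; do 2!case: ifP => ?; lia.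
Qed.

(* The pairing of the Dyck path [ud u (ud)^(n-2) d]. *)
Lemma exists_shifted_pairing n : exists2 t : 'S_(2 * n), noncrossing t
  & forall i : 'I_(2 * n), t i = (if i <= 1 then 1 - i
      else if i == 2 :> nat then (2 * n).-1
      else if i == (2 * n).-1 :> nat then 2
      else if odd i then i.+1 else i.-1) :> nat.
Proof.
pose f i := if i <= 1 then 1 - i else if i == 2 then (2 * n).-1
  else if i == (2 * n).-1 then 2 else if odd i then i.+1 else i.-1.
apply: (@noncrossing_fun _ f) => [i iN|i j].
- by split; [| | rewrite [f i]/f; do !case: ifP => ?];
    rewrite /f; do !case: ifP => ? //=; lia.
- by rewrite /f; do !case: ifP => ?; lia.
Qed.

(** For labels below [N], the last two cases are the wrap-around between [N - 1] and 0. *)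
Definition cyclic_adjacent N (a b : nat) : Prop :=
  [\/ b = a.+1, a = b.+1, a.+1 = b + N | b.+1 = a + N].

Lemma preserver_adjacent01 n (g : 'S_(2 * n)) (i0 i1 : 'I_(2 * n)) :
    g \in preserver (2 * n) -> i0 = 0 :> nat -> i1 = 1 :> nat ->
  cyclic_adjacent (2 * n) (g i0) (g i1).
Proof.
move=> /preserverP gP e0 e1.
have [t0 /gP nc0 t0E] := exists_ud_pairing n.
have [t1 /gP nc1 t1E] := exists_shifted_pairing n.
pose arc z := minn (g i0) (g i1) < z < maxn (g i0) (g i1).
have arcP (t : 'S_(2 * n)) (k k' : 'I_(2 * n)) : noncrossing (t ^ g)%g ->
    t i0 = i1 -> t k = k' -> 1 < k -> arc (g k) = arc (g k').
  move=> nct t01 tk k1; rewrite /arc -tk -t01 -!(permJ t g).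
  by apply: noncrossing_sides => //; rewrite ?permJ (inj_eq perm_inj) ?t01
    -val_eqE /=; lia.
have t0i : t0 i0 = i1 by apply/val_inj; rewrite /= t0E e0 e1.
have t1i : t1 i0 = i1 by apply/val_inj; rewrite /= t1E e0 e1.
(* The links of the chain alternate: [t1] joins an odd [k] to [k.+1], and [t0] an even one. *)
have arcS (k k' : 'I_(2 * n)) : 1 < k -> k' = k.+1 :> nat -> arc (g k) = arc (g k').
  move=> k1 ek; have k'N := ltn_ord k'.
  have [ok|ek2] := boolP (odd k).
    by apply: (arcP t1) => //; apply/val_inj; rewrite /= t1E; do !case: ifP; lia.
  by apply: (arcP t0) => //; apply/val_inj; rewrite /= t0E; case: ifP; lia.
have arc2 (k k' : 'I_(2 * n)) : k = 2 :> nat -> 1 < k' -> arc (g k') = arc (g k).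
  move=> ek; case: k' => m; elim: m => // m IH mN /= m1.
  have [e|m2] := eqVneq m 1.
    by congr (arc (val (g _))); apply/val_inj; rewrite /= ek e.
  have m1' : 1 < m by lia.
  by rewrite -(IH (ltnW mN) m1'); apply/esym/arcS.
have arc_eq (k k' : 'I_(2 * n)) : 1 < k -> 1 < k' -> arc (g k) = arc (g k').
  move=> k1 k'1; have N2 : 2 < 2 * n by have := ltn_ord k; lia.
  by rewrite !(@arc2 (Ordinal N2)).
have arc_const (z z' : 'I_(2 * n)) : z != g i0 -> z != g i1 -> z' != g i0 ->
    z' != g i1 -> arc z = arc z'.
  rewrite -(permKV g z) -(permKV g z') !(inj_eq perm_inj) -!val_eqE /= e0 e1.
  by move=> *; apply: arc_eq; lia.
have g01 : g i0 != g i1 :> nat by rewrite val_eqE (inj_eq perm_inj) -val_eqE /= e0 e1.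
have x_lt := ltn_ord (g i0); have y_lt := ltn_ord (g i1).
pose lo := minn (g i0) (g i1); pose hi := maxn (g i0) (g i1).
have noarc z z' : z < 2 * n -> z' < 2 * n -> lo < z < hi -> (z' < lo) || (hi < z') -> False.
  move=> zN z'N h h'.
  have := arc_const (Ordinal zN) (Ordinal z'N).
  by rewrite -!val_eqE /arc /=; move: h h'; rewrite /lo /hi; lia.
(* Unless [hi = lo.+1], the point [lo.+1] is inside. An outside point is [hi.+1] or [lo.-1], and
   both fail only when [lo] is 0 and [hi] is the last label. *)
have := noarc lo.+1 hi.+1; have := noarc lo.+1 lo.-1.
rewrite /lo /hi /cyclic_adjacent; move: g01 x_lt y_lt.
move: (val (g i0)) (val (g i1)) => x y *.
have [?|?] := eqVneq y x.+1; first by constructor 1.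
have [?|?] := eqVneq x y.+1; first by constructor 2.
have [?|?] := eqVneq x.+1 (y + 2 * n); first by constructor 3.
have [?|?] := eqVneq y.+1 (x + 2 * n); first by constructor 4.
lia.
Qed.

Lemma preserver_adjacent n (g : 'S_(2 * n)) (i j : 'I_(2 * n)) :
    g \in preserver (2 * n) -> j = i.+1 :> nat ->
  cyclic_adjacent (2 * n) (g i) (g j).
Proof.
move=> gP ij; have jN := ltn_ord j.
have N0 : 0 < 2 * n by lia.
have N1 : 1 < 2 * n by lia.
(* Products act left to right, so the rotation first carries 0 and 1 to [i] and [j]. *)
have hP : (rho n ^+ i * g)%g \in preserver (2 * n).
  by rewrite groupM // groupX // rho_preserver.
have := @preserver_adjacent01 n _ (Ordinal N0) (Ordinal N1) hP erefl erefl.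
rewrite !permM.
have -> : (rho n ^+ i)%g (Ordinal N0) = i.
  by apply/val_inj; rewrite /= rhoX_val add0n modn_small.
suff -> : (rho n ^+ i)%g (Ordinal N1) = j by [].
by apply/val_inj; rewrite /= rhoX_val add1n -ij modn_small.
Qed.

(** * From adjacency to membership in the dihedral group *)

(** By strong induction, [g i] is adjacent to the fixed label [i - 1], so it is [i] or [i - 2], and
    [i - 2] is already its own image. *)
Lemma preserver_fix01 n (g : 'S_(2 * n)) : g \in preserver (2 * n) ->
  (forall i : 'I_(2 * n), i <= 1 -> g i = i) -> g = 1%g.
Proof.
move=> gP fix01; apply/permP=> i; rewrite perm1.
have [m] := ubnP (nat_of_ord i); elim: m i => // m IH i im.
have [|i1] := leqP i 1; first exact: fix01.
have iN := ltn_ord i.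
have p1 : i.-1 < 2 * n by lia.
have p2 : i.-2 < 2 * n by lia.
have g1 : g (Ordinal p1) = Ordinal p1 by apply: IH => /=; lia.
have g2 : g (Ordinal p2) = Ordinal p2 by apply: IH => /=; lia.
have ne : g i != Ordinal p2.
  by rewrite -g2 (inj_eq perm_inj) -val_eqE /=; lia.
have := @preserver_adjacent n g (Ordinal p1) i gP; rewrite g1 /=.
move=> /(_ ltac:(lia)) H; apply/val_inj; move: ne H (ltn_ord (g i)).
by rewrite -val_eqE /= => ne [] ?; lia.
Qed.

Lemma rho_in_G n : rho n \in G n.
Proof. by rewrite mem_gen // !inE eqxx. Qed.

Lemma omega_in_G n : omega n \in G n.
Proof. by rewrite mem_gen // !inE eqxx orbT. Qed.

(** The image of 1 is a neighbour of 0: either 1, and [g] is the identity, or the last label, and a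
    reflection brings it back to 1. *)
Lemma preserver_fix0_in_G n (g : 'S_(2 * n)) : g \in preserver (2 * n) ->
  (forall i : 'I_(2 * n), i = 0 :> nat -> g i = i) -> g \in G n.
Proof.
move=> gP fix0.
have [n0|n_gt0] := posnP n.
  suff -> : g = 1%g by exact: group1.
  by apply/permP=> i; have := ltn_ord i; rewrite {2}n0.
have N0 : 0 < 2 * n by lia.
have N1 : 1 < 2 * n by lia.
pose i0 := Ordinal N0; pose i1 := Ordinal N1.
have g0 : g i0 = i0 by exact: fix0.
have [e|ne] := eqVneq (g i1) i1.
  suff -> : g = 1%g by exact: group1.
  apply: preserver_fix01 => // i i_le1.
  have [ei|ei] := eqVneq i i0; first by rewrite ei.
  suff -> : i = i1 by [].
  by apply/val_inj; move: ei; rewrite -val_eqE /=; lia.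
have gl : g i1 = (2 * n).-1 :> nat.
  have := @preserver_adjacent n g i0 i1 gP erefl; rewrite g0 /=.
  by move: ne (ltn_ord (g i1)); rewrite -val_eqE /= => ? ? []; lia.
(* [omega * rho ^+ 2] is the reflection fixing the first label. *)
have rG : (omega n * rho n ^+ 2)%g \in G n.
  by rewrite groupM ?groupX ?rho_in_G ?omega_in_G.
rewrite -(groupMr _ rG).
suff -> : (g * (omega n * rho n ^+ 2))%g = 1%g by exact: group1.
apply: preserver_fix01 => [|i i_le1].
  by rewrite groupM // (subsetP (G_sub_preserver n)).
have n1 : n != 1.
  by apply/eqP=> n1; move: ne; rewrite -val_eqE /= gl n1.
(* [omega] sends 0 to [2 * n - 2] and fixes [2 * n - 1]; adding 2 modulo [2 * n] then gives 0 and
   1. *)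
apply/val_inj; rewrite /= 2!permM rhoX_val omega_val.
have [ei|ei] := eqVneq (val i) 0.
  have -> : i = i0 by apply/val_inj.
  rewrite g0 /= ifF; last by lia.
  by rewrite subnK ?modnn; lia.
have -> : i = i1 by apply/val_inj; move: ei => /=; lia.
rewrite gl ifT; last by lia.
have -> : (2 * n).-1 + 2 = 1 + 2 * n by lia.
by rewrite modnDr modn_small.
Qed.

Lemma preserver_sub_G n : preserver (2 * n) \subset G n.
Proof.
apply/subsetP=> g gP.
have [n0|n_gt0] := posnP n.
  suff -> : g = 1%g by exact: group1.
  by apply/permP=> i; have := ltn_ord i; rewrite {2}n0.
have N0 : 0 < 2 * n by lia.
(* This power of the rotation takes the image of 0 back to 0. *)
pose k := 2 * n - g (Ordinal N0).
have rG : (rho n ^+ k)%g \in G n by rewrite groupX ?rho_in_G.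
rewrite -(groupMr _ rG); apply: preserver_fix0_in_G => [|i ei].
  by rewrite groupM // (subsetP (G_sub_preserver n)).
have -> : i = Ordinal N0 by apply/val_inj.
apply/val_inj; rewrite /= permM rhoX_val subnKC ?modnn //.
exact: ltnW.
Qed.

Theorem theorem7 (n : nat) (hn : 1 <= n) (g : 'S_(2 * n)) :
  (forall D : dyck n, is_path (relabel D g)) <-> g \in G n.
Proof.
split=> [/relabel_path_preserver|gG]; first exact/subsetP/preserver_sub_G.
exact/relabel_path_preserver/(subsetP (G_sub_preserver n)).
Qed.
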